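(* Let $G=(L,R,E)$ be a finite bipartite graph whose vertex sets $L$ and $R$ are each equipped with a linear ordering $\succ$, and suppose $G$ has an $L$-saturating matching with the PBT-property. Then the matching $M^{PBT}_G$ returned by the procedure $P^{PBT}_{greedy}$ is $L$-saturating, and among all $L$-saturating matchings of $G$ with the PBT-property, $M^{PBT}_G$ has the smallest order.
   Context: Write $x\sim y$ if $\{x,y\}\in E$. Let $y_1\succ\dots\succ y_N$ list $R$ in order of preference. A matching $M$ is $L$-saturating if every vertex of $L$ is matched by $M$; its order is the smallest $k$ such that $M$ is $L$-saturating and leaves $y_{k+1},\dots,y_N$ unmatched (order $\infty$ if $M$ is not $L$-saturating). An $L$-saturating matching $M$ has the PBT-property if for all $x,x'\in L$, $y\in R$ with $y$ the $M$-partner of $x$ and $x'\succ x$, we have $x'\not\sim y$. For a matching $M$, let $L_M$ be the set of vertices of $L$ unmatched by $M$ that are adjacent to some vertex of $R$ unmatched by $M$, and $R_M$ the analogous subset of $R$. Procedure $P^{PBT}_{greedy}$: start with $M=\emptyset$ and repeat: (1) if $L_M=\emptyset$, return $M$; otherwise let $x^*$ be the most preferred vertex of $L_M$ and let $R'_M=\{y\in R_M : y\sim x^* \text{ and } y\not\sim x' \text{ for every } x'\in L \text{ with } x'\succ x^*\}$; (2) if $R'_M=\emptyset$, return $M$; otherwise let $y^*$ be the most preferred vertex of $R'_M$ and add $\{x^*,y^*\}$ to $M$. The returned matching is $M^{PBT}_G$. *)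

(* Defs.v *)
From HB Require Import structures.
From mathcomp Require Import all_boot all_order.

Set Implicit Arguments.
Unset Strict Implicit.
Unset Printing Implicit Defensive.

Import Order.TTheory.

Local Open Scope order_scope.

(* The bipartite graph is given by its edge set E, with sides L and R.  On    *)
(* both sides "u is preferred to v" is v < u, so that the most preferred      *)
(* vertex of a set is its greatest element.                                   *)

Definition most_preferred (d : Order.disp_t) (T : finOrderType d)
    (A : {set T}) : option T :=
  [pick u in A | [forall v in A, v <= u]].

Section Matchings.

Variables (dL dR : Order.disp_t).
Variables (L : finOrderType dL) (R : finOrderType dR).

Implicit Types (E M : {set L * R}) (x : L) (y : R).

Definition is_matching E M : Prop :=
  [/\ M \subset E,
      forall x y y', (x, y) \in M -> (x, y') \in M -> y = y'
    & forall x x' y, (x, y) \in M -> (x', y) \in M -> x = x'].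

Definition matchedL M x : bool := [exists y, (x, y) \in M].
Definition matchedR M y : bool := [exists x, (x, y) \in M].

Definition L_saturating M : bool := [forall x, matchedL M x].

(* The list y_1, ..., y_N of R, most preferred vertex first. *)
Definition preference_list : seq R := sort >=%O (enum R).

(* y_{k+1}, ..., y_N are unmatched: y_i is the item of index i - 1. *)
Definition tail_unmatched M (k : nat) : bool :=
  all (fun y => ~~ matchedR M y) (drop k preference_list).

Lemma tail_unmatched_ex M : exists k, tail_unmatched M k.
Proof. by exists (size preference_list); rewrite /tail_unmatched drop_size. Qed.

(* None stands for the infinite order. *)
Definition matching_order M : option nat :=
  if L_saturating M then Some (ex_minn (tail_unmatched_ex M)) else None.

Definition le_order (k l : option nat) : bool :=
  match k, l with
  | _, None => true
  | None, Some _ => false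
  | Some m, Some n => (m <= n)%N
  end.

Definition PBT E M : Prop :=
  forall x x' y, (x, y) \in M -> x < x' -> (x', y) \notin E.

Definition availL E M : {set L} :=
  [set x | ~~ matchedL M x &
           [exists y, ~~ matchedR M y && ((x, y) \in E)]].

Definition availR E M : {set R} :=
  [set y | ~~ matchedR M y &
           [exists x, ~~ matchedL M x && ((x, y) \in E)]].

(* The set R'_M of the greedy procedure, for x* = x. *)
Definition candR E M x : {set R} :=
  [set y in availR E M | ((x, y) \in E) &
                         [forall x', (x < x') ==> ((x', y) \notin E)]].

(* One round of the procedure; None means that it returns M. *)
Definition greedy_step E M : option {set L * R} :=
  if most_preferred (availL E M) is Some x then
    if most_preferred (candR E M x) is Some y then Some ((x, y) |: M)
    else None
  else None.

Fixpoint greedy_run E (n : nat) M : {set L * R} :=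
  if n is n'.+1 then
    if greedy_step E M is Some M' then greedy_run E n' M' else M
  else M.

(* Each round matches a new vertex of L, so #|L| rounds are enough: see       *)
(* greedy_PBT_stops.                                                          *)
Definition greedy_PBT E : {set L * R} := greedy_run E #|L| set0.

Lemma greedy_step_matchedL E M M' : greedy_step E M = Some M' ->
  (#|[set x | matchedL M x]| < #|[set x | matchedL M' x]|)%N.
Proof.
rewrite /greedy_step /most_preferred.
case: pickP => // x /andP[]; rewrite inE => /andP[xM _] _.
case: pickP => // y _ [<-]; apply: proper_card; apply/properP; split.
  apply/subsetP => z; rewrite !inE => /existsP[t zt].
  by apply/existsP; exists t; rewrite inE zt orbT.
exists x; rewrite inE //.
by apply/existsP; exists y; rewrite !inE eqxx.
Qed.

Lemma greedy_PBT_stops E : greedy_step E (greedy_PBT E) = None.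
Proof.
have run_stops n M : (#|L| <= n + #|[set x | matchedL M x]|)%N ->
    greedy_step E (greedy_run E n M) = None; last first.
  by apply: run_stops; exact: leq_addr.
elim: n M => [|n IHn] M /=.
  rewrite add0n => leM; case EM: (greedy_step E M) => [M'|//].
  have := leq_trans (leq_ltn_trans leM (greedy_step_matchedL EM)) (max_card _).
  by rewrite ltnn.
case EM: (greedy_step E M) => [M'|//] leM; apply: IHn.
apply: leq_trans leM _; rewrite addSn -addnS leq_add2l.
exact: greedy_step_matchedL EM.
Qed.

End Matchings.

(* Main.v *)
Require Import Defs.
From HB Require Import structures.
From mathcomp Require Import all_boot all_order.

Set Implicit Arguments.
Unset Strict Implicit.
Unset Printing Implicit Defensive.

Import Order.TTheory.

Local Open Scope order_scope.

(* The sets T(x) of the right vertices whose most preferred neighbour is x are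
   pairwise disjoint, and a matching has the PBT-property exactly when it pairs
   each matched x with an element of T(x). Choices for different x therefore
   never interfere, and the greedy procedure picks the most preferred element
   of every T(x). *)

Lemma most_preferred_Some (d : Order.disp_t) (T : finOrderType d)
    (A : {set T}) (u : T) :
  most_preferred A = Some u -> u \in A /\ {in A, forall v, v <= u}.
Proof.
rewrite /most_preferred; case: pickP => // w /andP[wA /forall_inP wmax] [<-].
by split.
Qed.

Lemma most_preferred_neq0 (d : Order.disp_t) (T : finOrderType d)
    (A : {set T}) (v : T) : v \in A -> exists u, most_preferred A = Some u.
Proof.
move=> vA; rewrite /most_preferred; case: pickP => [u _|noMax]; first by exists u.
have [u uA umax] := @arg_maxP _ _ _ v (mem A) id vA.
by have /negP[] := noMax u; apply/andP; split=> //; apply/forall_inP.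
Qed.

(** Every item cut off by [drop] is at least every item kept, so [z <= y] with [z] in the prefix
    forces [z = y]. *)
Lemma mem_drop_sorted_ge (d : Order.disp_t) (T : orderType d) (s : seq T)
    (k : nat) (y z : T) :
  sorted >=%O s -> y \in drop k s -> z \in s -> z <= y -> z \in drop k s.
Proof.
rewrite (sorted_pairwise ge_trans) -{1 3}(cat_take_drop k s) pairwise_cat.
move=> /andP[/allrelP ge_td _] yd; rewrite mem_cat => /orP[zt zy|//].
have yz : y <= z := ge_td z y zt yd.
by have -> : z = y by apply/eqP; rewrite eq_le zy yz.
Qed.

Section TopNeighbour.

Variables (dL dR : Order.disp_t).
Variables (L : finOrderType dL) (R : finOrderType dR).
Variable E : {set L * R}.

Implicit Types (M : {set L * R}) (x : L) (y : R).

(** This is T(x): the condition of [candR] without its dependence on the current matching. *)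
Definition top_neighbour_set x : {set R} :=
  [set y | ((x, y) \in E) & [forall x', (x < x') ==> ((x', y) \notin E)]].

(** The invariant of the greedy run: every intermediate matching stays inside this fixed set. *)
Definition best_top_pairs : {set L * R} :=
  [set p | (p.2 \in top_neighbour_set p.1) &
           [forall y in top_neighbour_set p.1, y <= p.2]].

Lemma top_neighbour_inj x x' y :
  y \in top_neighbour_set x -> y \in top_neighbour_set x' -> x = x'.
Proof.
rewrite !inE => /andP[xy /forallP topx] /andP[x'y /forallP topx'].
case: (ltgtP x x') => // [xx'|x'x].
- by have := topx x'; rewrite xx' x'y.
- by have := topx' x; rewrite x'x xy.
Qed.

Lemma best_top_pairsP x y :
  reflect (y \in top_neighbour_set x /\
           {in top_neighbour_set x, forall z, z <= y})
          ((x, y) \in best_top_pairs).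
Proof.
by rewrite [X in reflect _ X]inE /=; apply: (iffP andP) => -[? /forall_inP].
Qed.

(** Two partners of one [x] are both greatest in T(x), and two partners of one [y] contradict the
    disjointness of the sets T(x). *)
Lemma best_top_pairs_matching M :
  M \subset best_top_pairs -> is_matching E M.
Proof.
move=> /subsetP sM; split.
- apply/subsetP => -[x y] /sM /best_top_pairsP[].
  by rewrite inE => /andP[].
- move=> x y y' /sM /best_top_pairsP[ty my] /sM /best_top_pairsP[ty' my'].
  by apply/eqP; rewrite eq_le my ?my'.
- move=> x x' y /sM /best_top_pairsP[ty _] /sM /best_top_pairsP[ty' _].
  exact: top_neighbour_inj ty ty'.
Qed.

Lemma PBT_top_neighbour M :
  M \subset E ->
  PBT E M <-> (forall x y, (x, y) \in M -> y \in top_neighbour_set x).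
Proof.
move=> /subsetP sM; split=> [pbt x y xy|top x x' y xy xx'].
  rewrite inE sM //=; apply/forallP => x'; apply/implyP; exact: pbt xy.
by have := top x y xy; rewrite inE => /andP[_ /forallP/(_ x')]; rewrite xx'.
Qed.

Lemma best_top_pairs_unmatchedR M x y :
  M \subset best_top_pairs -> ~~ matchedL M x -> y \in top_neighbour_set x ->
  ~~ matchedR M y.
Proof.
move=> /subsetP sM xM ty; apply/existsP => -[x' x'y].
have [ty' _] := best_top_pairsP _ _ (sM _ x'y).
by case/existsP: xM; exists y; rewrite (top_neighbour_inj ty ty').
Qed.

(** As long as [x] is unmatched, nothing in T(x) has been taken, and [x] itself witnesses the
    availability of its elements. *)
Lemma candR_top_neighbour M x :
  M \subset best_top_pairs -> ~~ matchedL M x ->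
  candR E M x = top_neighbour_set x.
Proof.
move=> sM xM; apply/setP => y; rewrite [RHS]inE inE.
apply: andb_idl => ty; rewrite inE (best_top_pairs_unmatchedR sM xM) ?inE //.
by apply/existsP; exists x; rewrite xM; case/andP: ty.
Qed.

Lemma greedy_step_best_top_pairs M M' :
  M \subset best_top_pairs -> greedy_step E M = Some M' ->
  M' \subset best_top_pairs.
Proof.
move=> sM; rewrite /greedy_step.
case Ex: (most_preferred _) => [x|//]; case Ey: (most_preferred _) => [y|//].
case=> <-; have [+ _] := most_preferred_Some Ex; rewrite inE => /andP[xM _].
rewrite subUset sM sub1set andbT; apply/best_top_pairsP.
by rewrite -(candR_top_neighbour sM xM); exact: most_preferred_Some Ey.
Qed.

Lemma greedy_PBT_best_top_pairs : greedy_PBT E \subset best_top_pairs.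
Proof.
rewrite /greedy_PBT; move: #|L| => n.
elim: n set0 (sub0set best_top_pairs) => [//|n IHn] M sM /=.
case EM: (greedy_step E M) => [M'|//]; apply: IHn.
exact: greedy_step_best_top_pairs EM.
Qed.

(** An unmatched [x] would make [availL] nonempty, so a further round would be possible after the
    procedure has stopped. *)
Lemma greedy_PBT_saturating :
  (forall x, exists y, y \in top_neighbour_set x) ->
  L_saturating (greedy_PBT E).
Proof.
move=> top; have := greedy_PBT_stops E; have := greedy_PBT_best_top_pairs.
move: (greedy_PBT E) => M sM stop; apply/forallP => x; apply: contraT => xM.
have [y ty] := top x.
have xA : x \in availL E M.
  rewrite inE xM; apply/existsP; exists y.
  rewrite (best_top_pairs_unmatchedR sM xM ty) /=.
  by move: ty; rewrite inE => /andP[].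
have [x0 Ex0] := most_preferred_neq0 xA.
have [+ _] := most_preferred_Some Ex0; rewrite inE => /andP[x0M _].
(* The vertex [x0] chosen by the round may differ from [x], so T(x0) has to be nonempty as well. *)
have [y0 ty0] := top x0; rewrite -(candR_top_neighbour sM x0M) in ty0.
have [y1 Ey1] := most_preferred_neq0 ty0.
by move: stop; rewrite /greedy_step Ex0 Ey1.
Qed.

(** If the greedy partner [y] of [x] were in the tail, so would be the partner [z] of [x] in [M]: it
    lies in T(x), hence [z <= y]. *)
Lemma tail_unmatched_greedy M k :
  M \subset E -> L_saturating M -> PBT E M ->
  tail_unmatched M k -> tail_unmatched (greedy_PBT E) k.
Proof.
move=> ME /forallP satM /(PBT_top_neighbour ME) topM /allP tailM.
apply/allP => y yd; apply/existsP => -[x xy].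
have [_ ymax] := best_top_pairsP _ _ (subsetP greedy_PBT_best_top_pairs _ xy).
have /existsP[z xz] := satM x.
have zd : z \in drop k (preference_list R).
  apply: (mem_drop_sorted_ge _ yd) (ymax _ (topM _ _ xz)).
    exact/sort_sorted/ge_total.
  by rewrite mem_sort mem_enum.
by have /existsP[] := tailM z zd; exists x.
Qed.

End TopNeighbour.

Local Close Scope order_scope.

Theorem theorem3 (dL dR : Order.disp_t)
    (L : finOrderType dL) (R : finOrderType dR) (E : {set L * R}) :
  (exists M : {set L * R}, [/\ is_matching E M, L_saturating M & PBT E M]) ->
  [/\ is_matching E (greedy_PBT E),
      L_saturating (greedy_PBT E),
      PBT E (greedy_PBT E)
    & forall M : {set L * R},
        is_matching E M -> L_saturating M -> PBT E M ->
        le_order (matching_order (greedy_PBT E)) (matching_order M)].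
Proof.
move=> [M0 [[M0E _ _] /forallP sat0 /(PBT_top_neighbour M0E) top0]].
have sG := greedy_PBT_best_top_pairs E.
have mG := best_top_pairs_matching sG; have [GE _ _] := mG.
have satG : L_saturating (greedy_PBT E).
  (* The partner of [x] in [M0] shows that T(x) is nonempty. *)
  apply: greedy_PBT_saturating => x.
  by have /existsP[y /top0 ty] := sat0 x; exists y.
split=> //.
  by apply/PBT_top_neighbour => // x y /(subsetP sG) /best_top_pairsP[].
move=> M [ME _ _] satM pbtM; rewrite /matching_order satG satM /=.
case: ex_minnP => m _ mmin; case: ex_minnP => n tn _.
(* Here [m] is the order of the greedy matching and [n] that of [M]; by minimality of [m] it
   suffices that the greedy matching avoids the tail after [n]. *)
by apply: mmin; exact: tail_unmatched_greedy tn.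
Qed.
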